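(* Let target rates $\mathcal I^0_l>0$ be given, let $M_l=\mathrm{Rank}(H_{l,l})$ and $\gamma^0_l=e^{\mathcal I^0_l/M_l}-1$, and consider $$\textbf{SPMP}:\ \min_{\Sigma_{1:L}}\sum_{l=1}^L\mathrm{Tr}(\Sigma_l)\ \text{ s.t. } \mathcal I_l(\Sigma_{1:L},\Phi)\ge\mathcal I^0_l,\ \Sigma_l\succeq0,\ l=1,\dots,L,$$ $$\textbf{ESPMP}:\ \min_{\{T,R,p\}}\|p\|_1\ \text{ s.t. } \gamma_{l,m}\ge\gamma^0_l,\ 1\le m\le M_l,\ 1\le l\le L.$$ If $\{\tilde T,\tilde R,\tilde p\}$ is an optimum of ESPMP, then the input covariance matrices $\tilde\Sigma_l=\sum_m\tilde p_{l,m}\tilde t_{l,m}\tilde t_{l,m}^\dagger$ form an optimum of SPMP. Conversely, if $\tilde\Sigma_{1:L}$ is an optimum of SPMP, then there exists a decomposition of it leading to a strategy $\{\tilde T,\tilde R,\tilde p\}$ that is an optimum of ESPMP.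
   Context: A MIMO B-MAC network has $L$ data links. Link $l$ has transmitter $T_l$ with $L_{T_l}$ antennas and receiver $R_l$ with $L_{R_l}$ antennas; $H_{l,k}\in\mathbb C^{L_{R_l}\times L_{T_k}}$ is the channel matrix from $T_k$ to $R_l$. The input of link $k$ is circularly symmetric complex Gaussian with covariance $\Sigma_k\succeq0$, and the noise at each receiver is circularly symmetric complex Gaussian with identity covariance. A coupling matrix $\Phi\in\{0,1\}^{L\times L}$ with $\Phi_{l,l}=0$ specifies whether the signal of link $k$ still interferes with link $l$ after interference cancellation ($\Phi_{l,k}=1$) or is completely cancelled ($\Phi_{l,k}=0$); $\Phi$ is assumed valid, i.e. realizable by a scheme in which each signal is decoded by at most one receiver. For $\Sigma_{1:L}$ let $\Omega_l=I+\sum_{k=1}^L\Phi_{l,k}H_{l,k}\Sigma_kH_{l,k}^\dagger$ and $\mathcal I_l(\Sigma_{1:L},\Phi)=\log\left|I+H_{l,l}\Sigma_lH_{l,l}^\dagger\Omega_l^{-1}\right|$. The problems are assumed feasible. Streams: with $M_l$ streams for link $l$, a strategy $\{T,R,p\}$ consists of unit-norm transmit vectors $t_{l,m}\in\mathbb C^{L_{T_l}}$ (collected in $T$), powers $p_{l,m}\ge0$ (collected in $p$), and unit-norm receive vectors $r_{l,m}$ (collected in $R$); it corresponds to input covariances $\Sigma_l=\sum_m p_{l,m}t_{l,m}t_{l,m}^\dagger$ (a ''decomposition'' of $\Sigma_{1:L}$). Streams of link $l$ are decoded in order $m=1,\dots,M_l$ with cancellation. Cross-talk coefficients: $\Psi^{k,n}_{l,m}=0$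 if $k=l,m\ge n$; $=|r_{l,m}^\dagger H_{l,l}t_{l,n}|^2$ if $k=l,m<n$; $=\Phi_{l,k}|r_{l,m}^\dagger H_{l,k}t_{k,n}|^2$ otherwise. SINR: $\gamma_{l,m}=\dfrac{p_{l,m}|r_{l,m}^\dagger H_{l,l}t_{l,m}|^2}{1+\sum_{k}\sum_{n=1}^{M_k}p_{k,n}\Psi^{k,n}_{l,m}}$. *)

(* Defs.v *)
From HB Require Import structures.
From mathcomp Require Import all_boot all_order all_algebra.
Unset Printing Implicit Defensive.
Import Order.TTheory GRing.Theory Num.Theory.
Local Open Scope ring_scope.

Section Defs.
Variable C : numClosedFieldType.

Definition adjmx m n (A : 'M[C]_(m, n)) : 'M[C]_(n, m) := map_mx Num.conj A^T.
Arguments adjmx {m n}.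

Definition psd n (A : 'M[C]_n) : Prop :=
  adjmx A = A /\ forall v : 'cV[C]_n, 0 <= (adjmx v *m A *m v) 0 0.
Arguments psd {n}.

Variables (L : nat) (nT nR : 'I_L -> nat).
Variable H : forall l k : 'I_L, 'M[C]_(nR l, nT k).
Variable Phi : 'I_L -> 'I_L -> bool.

Definition covs := forall k : 'I_L, 'M[C]_(nT k).

Definition Omega (S : covs) (l : 'I_L) : 'M[C]_(nR l) :=
  1%:M + \sum_(k < L) (if Phi l k then H l k *m S k *m adjmx (H l k) else 0).

(* |I + H_{l,l} Sigma_l H_{l,l}^dagger Omega_l^{-1}| ; I_l = log of this *)
Definition rate_det (S : covs) (l : 'I_L) : C :=
  \det (1%:M + H l l *m S l *m adjmx (H l l) *m invmx (Omega S l)).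

Definition total_power (S : covs) : C := \sum_(l < L) \tr (S l).

Definition Mstreams (l : 'I_L) : nat := \rank (H l l).

Variable gamma0 : 'I_L -> C.

(* SPMP constraints, with I_l >= I^0_l written as
   |...| >= e^{I^0_l} = (1 + gamma^0_l)^{M_l} *)
Definition spmp_feasible (S : covs) : Prop :=
  forall l, psd (S l) /\ (1 + gamma0 l) ^+ Mstreams l <= rate_det S l.

Definition spmp_optimal (S : covs) : Prop :=
  spmp_feasible S /\ forall S', spmp_feasible S' -> total_power S <= total_power S'.

Definition tvecs := forall l : 'I_L, 'I_(Mstreams l) -> 'cV[C]_(nT l).
Definition rvecs := forall l : 'I_L, 'I_(Mstreams l) -> 'cV[C]_(nR l).
Definition pows := forall l : 'I_L, 'I_(Mstreams l) -> C.

Definition unit_norm n (v : 'cV[C]_n) : Prop := (adjmx v *m v) 0 0 = 1.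
Arguments unit_norm {n}.

Definition valid_strategy (T : tvecs) (R : rvecs) (p : pows) : Prop :=
  forall l m, unit_norm (T l m) /\ unit_norm (R l m) /\ 0 <= p l m.

Definition Psi (T : tvecs) (R : rvecs) (l : 'I_L) (m : 'I_(Mstreams l))
    (k : 'I_L) (n : 'I_(Mstreams k)) : C :=
  (if k == l then ((m < n)%N)%:R else (Phi l k)%:R) *
  `|(adjmx (R l m) *m H l k *m T k n) 0 0| ^+ 2.

Definition sinr (T : tvecs) (R : rvecs) (p : pows) (l : 'I_L)
    (m : 'I_(Mstreams l)) : C :=
  p l m * `|(adjmx (R l m) *m H l l *m T l m) 0 0| ^+ 2 /
  (1 + \sum_(k < L) \sum_(n < Mstreams k) p k n * Psi T R l m k n).

Definition espmp_feasible (T : tvecs) (R : rvecs) (p : pows) : Prop :=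
  valid_strategy T R p /\ forall l m, gamma0 l <= sinr T R p l m.

Definition p_norm1 (p : pows) : C := \sum_(l < L) \sum_(m < Mstreams l) p l m.

Definition espmp_optimal (T : tvecs) (R : rvecs) (p : pows) : Prop :=
  espmp_feasible T R p /\
  forall T' R' p', espmp_feasible T' R' p' -> p_norm1 p <= p_norm1 p'.

Definition cov_of (T : tvecs) (p : pows) : covs :=
  fun l => \sum_(m < Mstreams l) p l m *: (T l m *m adjmx (T l m)).

End Defs.
Arguments adjmx {C m n}.
Arguments psd {C n}.
Arguments unit_norm {C n}.
Arguments Mstreams {C L nT nR} H l.
Arguments spmp_feasible {C L nT nR} H Phi gamma0 S.
Arguments spmp_optimal {C L nT nR} H Phi gamma0 S.
Arguments espmp_feasible {C L nT nR} H Phi gamma0 T R p.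
Arguments espmp_optimal {C L nT nR} H Phi gamma0 T R p.
Arguments cov_of {C L nT nR} H T p.

(* Main.v *)
(* Write every covariance as a Gram matrix, with columns [sqrt p_m t_m].
   A strategy feasible for ESPMP gives covariances feasible for SPMP because,
   by Cauchy-Schwarz, the SINR of a stream is at most [g^h W^-1 g], where [g] is
   its received direction and [W] the covariance of its interference plus noise,
   and the factors [1 + g^h W^-1 g] multiply to the determinant of the link.
   Conversely, a covariance feasible for SPMP dominates one that is seen
   identically by its own receiver and has rank at most [M_l]; rotating the
   columns of a square root of the latter by a unitary matrix (the geometric mean
   decomposition) makes all the factors equal, and the streams so obtained meet
   the SINR targets. Shrinking the other covariances only lowers interference, so
   both problems have the same value, and an optimal covariance, having minimal
   trace, is equal to the one it dominates. *)
Require Import Defs.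
From HB Require Import structures.
From mathcomp Require Import all_boot all_order all_algebra ring.
Set Implicit Arguments.
Unset Strict Implicit.
Import Order.TTheory GRing.Theory Num.Theory.
Local Open Scope ring_scope.

Local Notation "A ^h" := (adjmx A) (at level 8, format "A ^h").

(** * Conjugate transposes, quadratic forms and positive matrices *)

Section PositiveMatrices.
Variable C : numClosedFieldType.

Lemma adjmxE m n (A : 'M[C]_(m, n)) i j : A^h i j = (A j i)^*.
Proof. by rewrite !mxE. Qed.

Lemma adjmxK m n (A : 'M[C]_(m, n)) : A^h^h = A.
Proof. by apply/matrixP=> i j; rewrite !adjmxE conjCK. Qed.

Lemma adjmxM m n p (A : 'M[C]_(m, n)) (B : 'M[C]_(n, p)) :
  (A *m B)^h = B^h *m A^h.
Proof. by rewrite /adjmx trmx_mul map_mxM. Qed.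

Lemma adjmxD m n (A B : 'M[C]_(m, n)) : (A + B)^h = A^h + B^h.
Proof. by rewrite /adjmx linearD map_mxD. Qed.

Lemma adjmxB m n (A B : 'M[C]_(m, n)) : (A - B)^h = A^h - B^h.
Proof. by rewrite /adjmx linearB map_mxB. Qed.

Lemma adjmxZ m n a (A : 'M[C]_(m, n)) : (a *: A)^h = a^* *: A^h.
Proof. by apply/matrixP=> i j; rewrite !mxE rmorphM. Qed.

Lemma adjmx0 m n : (0 : 'M[C]_(m, n))^h = 0.
Proof. by apply/matrixP=> i j; rewrite !mxE conjC0. Qed.

Lemma adjmx1 n : (1%:M : 'M[C]_n)^h = 1%:M.
Proof. by rewrite /adjmx trmx1 map_mx1. Qed.

Lemma adjmx_inv n (A : 'M[C]_n) : (invmx A)^h = invmx A^h.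
Proof. by rewrite /adjmx trmx_inv map_invmx. Qed.

Lemma det_adjmx n (A : 'M[C]_n) : \det A^h = (\det A)^*.
Proof. by rewrite /adjmx det_map_mx det_tr. Qed.

Lemma mulmx11 (A B : 'M[C]_1) : (A *m B) 0 0 = A 0 0 * B 0 0.
Proof. by rewrite mxE big_ord1. Qed.

Definition qform n (A : 'M[C]_n) (v : 'cV[C]_n) : C := (v^h *m A *m v) 0 0.

Lemma qformD n (A B : 'M[C]_n) v : qform (A + B) v = qform A v + qform B v.
Proof. by rewrite /qform mulmxDr mulmxDl mxE. Qed.

Lemma qform0 n (v : 'cV[C]_n) : qform 0 v = 0.
Proof. by rewrite /qform mulmx0 mul0mx mxE. Qed.

Lemma qform_sum n I (r : seq I) (P : pred I) (F : I -> 'M[C]_n) v :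
  qform (\sum_(i <- r | P i) F i) v = \sum_(i <- r | P i) qform (F i) v.
Proof.
apply: (big_morph (fun A => qform A v)) => [A B|]; first exact: qformD.
exact: qform0.
Qed.

Lemma qformZ n a (A : 'M[C]_n) v : qform (a *: A) v = a * qform A v.
Proof. by rewrite /qform -scalemxAr -scalemxAl mxE. Qed.

Lemma qformZv n a (A : 'M[C]_n) v : qform A (a *: v) = `|a| ^+ 2 * qform A v.
Proof.
by rewrite /qform adjmxZ -scalemxAr -!scalemxAl !mxE mulrA normCK.
Qed.

Lemma qform_conj m n (A : 'M[C]_n) (B : 'M[C]_(n, m)) v :
  qform (B^h *m A *m B) v = qform A (B *m v).
Proof. by rewrite /qform adjmxM !mulmxA. Qed.

Lemma qform_rank1 n (g v : 'cV[C]_n) :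
  qform (g *m g^h) v = `|(v^h *m g) 0 0| ^+ 2.
Proof.
rewrite /qform mulmxA -mulmxA mulmx11 normCK -[(_ 0 0)^*]adjmxE.
by rewrite adjmxM adjmxK.
Qed.

(** The squared Frobenius norm: the trace of a Gram matrix controls every entry, which is how
    matrices are later shown to vanish. *)
Lemma trace_gram m n (A : 'M[C]_(m, n)) :
  \tr (A *m A^h) = \sum_i \sum_j `|A i j| ^+ 2.
Proof.
apply: eq_bigr => i _; rewrite mxE; apply: eq_bigr => j _.
by rewrite adjmxE normCK.
Qed.

Lemma trace_gram_ge0 m n (A : 'M[C]_(m, n)) : 0 <= \tr (A *m A^h).
Proof.
by rewrite trace_gram; do 2!apply: sumr_ge0 => ? _; rewrite exprn_ge0.
Qed.

Lemma trace_gram_eq0 m n (A : 'M[C]_(m, n)) : \tr (A *m A^h) = 0 -> A = 0.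
Proof.
rewrite trace_gram => s0; apply/matrixP => i j; rewrite mxE.
have ge0 k : 0 <= \sum_l `|A k l| ^+ 2.
  by apply: sumr_ge0 => ? _; rewrite exprn_ge0.
have /psumr_eq0P : \sum_l `|A i l| ^+ 2 = 0.
  by move/psumr_eq0P: s0 => ->.
by move/(_ (fun l _ => exprn_ge0 2 (normr_ge0 _)))/(_ j isT)/eqP;
  rewrite expf_eq0 /= normr_eq0 => /eqP.
Qed.

Lemma qform_gram m n (A : 'M[C]_(n, m)) v :
  qform (A *m A^h) v = \tr ((v^h *m A) *m (v^h *m A)^h).
Proof. by rewrite /qform trace_mx11 adjmxM adjmxK !mulmxA. Qed.

Lemma psd_gram m n (A : 'M[C]_(n, m)) : psd (A *m A^h).
Proof.
split; first by rewrite adjmxM adjmxK.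
by move=> v; rewrite -/(qform _ _) qform_gram trace_gram_ge0.
Qed.

Lemma scale_gram n a (v : 'cV[C]_n) : 0 <= a ->
  a *: (v *m v^h) = (sqrtC a *: v) *m (sqrtC a *: v)^h.
Proof.
move=> a_ge0; rewrite adjmxZ -scalemxAl -scalemxAr scalerA.
by rewrite geC0_conj ?sqrtC_ge0 // -expr2 sqrtCK.
Qed.

Lemma psdD n (A B : 'M[C]_n) : psd A -> psd B -> psd (A + B).
Proof.
move=> [hA pA] [hB pB]; split; first by rewrite adjmxD hA hB.
by move=> v; rewrite -/(qform _ _) qformD addr_ge0 //; [apply: pA|apply: pB].
Qed.

Lemma psd0 n : psd (0 : 'M[C]_n).
Proof.
by split; [rewrite adjmx0 | move=> v; rewrite mulmx0 mul0mx mxE].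
Qed.

Lemma psd_sum n I (r : seq I) (P : pred I) (F : I -> 'M[C]_n) :
  (forall i, P i -> psd (F i)) -> psd (\sum_(i <- r | P i) F i).
Proof. by move=> psdF; apply: big_ind => //; [apply: psd0|apply: psdD]. Qed.

Lemma psd_conj m n (A : 'M[C]_n) (B : 'M[C]_(n, m)) :
  psd A -> psd (B^h *m A *m B).
Proof.
move=> [hA pA]; split; first by rewrite !adjmxM adjmxK hA mulmxA.
by move=> v; rewrite -/(qform _ _) qform_conj; apply: pA.
Qed.

Definition posdef n (A : 'M[C]_n) : Prop :=
  A^h = A /\ forall v, v != 0 -> 0 < qform A v.

Lemma posdef_psd n (A : 'M[C]_n) : posdef A -> psd A.
Proof.
move=> [hA pA]; split=> // v; have [->|/pA/ltW//] := eqVneq v 0.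
by rewrite mulmx0 mxE.
Qed.

Lemma posdefD n (A B : 'M[C]_n) : posdef A -> psd B -> posdef (A + B).
Proof.
move=> [hA pA] [hB pB]; split; first by rewrite adjmxD hA hB.
by move=> v v0; rewrite qformD ltr_wpDr //; [apply: pB|apply: pA].
Qed.

Lemma qform1 n (v : 'cV[C]_n) : qform 1%:M v = (v^h *m v) 0 0.
Proof. by rewrite /qform mulmx1. Qed.

Lemma posdef1 n : posdef (1%:M : 'M[C]_n).
Proof.
split=> [|v v0]; first exact: adjmx1.
have ge0 : 0 <= qform 1%:M v.
  by rewrite -[1%:M]mulmx1 -{2}adjmx1; have [_] := psd_gram (1%:M : 'M[C]_n); apply.
rewrite lt0r ge0 andbT; apply: contraNneq v0 => q0.
suff /(congr1 (@adjmx _ _ _)) : v^h = 0 by rewrite adjmxK adjmx0 => ->.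
apply: trace_gram_eq0; rewrite adjmxK trace_mx11.
by rewrite -q0 qform1.
Qed.

Lemma unit_norm_neq0 n (v : 'cV[C]_n) : unit_norm v -> v != 0.
Proof.
by apply: contra_eq_neq => ->; rewrite mulmx0 mxE eq_sym oner_neq0.
Qed.

Lemma posdef_unit n (A : 'M[C]_n) : posdef A -> A \in unitmx.
Proof.
move=> [hA pA]; rewrite -unitmx_tr -row_free_unit -kermx_eq0.
apply/rowV0P => u /sub_kermxP uA0; apply/eqP/negPn/negP => u0.
have /pA : u^T != 0 by rewrite trmx_eq0.
rewrite /qform -mulmxA.
have -> : A *m u^T = 0 by apply: trmx_inj; rewrite trmx_mul trmxK trmx0.
by rewrite mulmx0 mxE ltxx.
Qed.

Lemma posdef_inv n (A : 'M[C]_n) : posdef A -> posdef (invmx A).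
Proof.
move=> pdA; have uA := posdef_unit pdA; have [hA pA] := pdA.
split; first by rewrite adjmx_inv hA.
move=> v v0; have -> : invmx A = (invmx A)^h *m A *m invmx A.
  by rewrite adjmx_inv hA mulVmx // mul1mx.
rewrite qform_conj pA //; apply: contraNneq v0 => v0.
by rewrite -[v](mulKVmx uA) v0 mulmx0.
Qed.

(** * Spectral theorem and square roots *)

Lemma spectral_decomposition n (A : 'M[C]_n) : A^h = A ->
  exists P : 'M[C]_n, exists d : 'rV[C]_n,
    P *m P^h = 1%:M /\ A = P^h *m diag_mx d *m P.
Proof.
move=> hA; exists (spectralmx A), (spectral_diag A).
have uP := spectral_unitarymx A.
split; first exact/unitarymxP.
have nA : A \is normalmx by apply/normalmxP; rewrite -/(adjmx A) hA.
by rewrite {1}(orthomx_spectralP nA) invmx_unitary.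
Qed.

Lemma unitary_adj n (P : 'M[C]_n) : P *m P^h = 1%:M -> P^h *m P = 1%:M.
Proof. exact: mulmx1C. Qed.

Lemma qform_diag n (d : 'rV[C]_n) v :
  qform (diag_mx d) v = \sum_i d 0 i * `|v i 0| ^+ 2.
Proof.
rewrite /qform -mulmxA mxE; apply: eq_bigr => i _.
by rewrite mul_diag_mx mxE adjmxE normCKC mulrCA.
Qed.

Lemma qform_diag_delta n (d : 'rV[C]_n) i :
  qform (diag_mx d) (delta_mx i 0) = d 0 i.
Proof.
rewrite qform_diag (bigD1 i) //= big1 => [|j ji].
  by rewrite mxE !eqxx normr1 expr1n mulr1 addr0.
by rewrite mxE (negPf ji) normr0 expr0n mulr0.
Qed.

Lemma psd_sqrt n (A : 'M[C]_n) : psd A -> exists F : 'M[C]_n, A = F *m F^h.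
Proof.
move=> [hA pA]; have [P [d [PP Ad]]] := spectral_decomposition hA.
have d_ge0 i : 0 <= d 0 i.
  rewrite -qform_diag_delta.
  have -> : diag_mx d = P^h^h *m A *m P^h.
    by rewrite adjmxK Ad !mulmxA PP mul1mx -mulmxA PP mulmx1.
  by rewrite qform_conj; apply: pA.
exists (P^h *m diag_mx (map_mx sqrtC d)).
rewrite adjmxM adjmxK -mulmxA [X in _ *m X]mulmxA Ad -mulmxA; congr (_ *m (_ *m _)).
have -> : (diag_mx (map_mx sqrtC d))^h = diag_mx (map_mx sqrtC d).
  apply/matrixP => i j; rewrite adjmxE !mxE eq_sym.
  have [->|_] := eqVneq i j; last by rewrite conjC0.
  by rewrite !mulr1n geC0_conj ?sqrtC_ge0.
rewrite mulmx_diag; congr diag_mx; apply/rowP => i.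
by rewrite !mxE -expr2 sqrtCK.
Qed.

(** * Determinants and the Cauchy-Schwarz inequality *)

Lemma posdef_det_gt0 n (A : 'M[C]_n) : posdef A -> 0 < \det A.
Proof.
move=> pdA; have [F AF] := psd_sqrt (posdef_psd pdA).
have := posdef_unit pdA; rewrite unitmxE unitfE AF det_mulmx det_adjmx -normCK.
by rewrite lt0r => ->; rewrite exprn_ge0.
Qed.

(* Both sides are the determinant of the block matrix [1, -G^h; G, W]. *)
Lemma det_add_gram m n (W : 'M[C]_n) (G : 'M[C]_(n, m)) : W \in unitmx ->
  \det (W + G *m G^h) = \det W * \det (1%:M + G^h *m invmx W *m G).
Proof.
move=> uW; pose M := block_mx 1%:M (- G^h) G W.
have -> : \det (W + G *m G^h) = \det M.
  have -> : M = block_mx 1%:M 0 G 1%:M *m block_mx 1%:M (- G^h) 0 (W + G *m G^h).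
    rewrite mulmx_block !mul1mx !mul0mx mulmx1 !addr0 mulmxN.
    by rewrite addrC addrK.
  by rewrite det_mulmx det_lblock det_ublock !det1 !mul1r.
have -> : M = block_mx 1%:M (- (G^h *m invmx W)) 0 1%:M *m
              block_mx (1%:M + G^h *m invmx W *m G) 0 G W.
  rewrite mulmx_block !mul1mx !mul0mx !mulNmx mulmxKV // add0r.
  by rewrite addrK !add0r.
by rewrite det_mulmx det_lblock det_ublock !det1 !mul1r mulrC.
Qed.

Lemma det_add_rank1 n (W : 'M[C]_n) (g : 'cV[C]_n) : W \in unitmx ->
  \det (W + g *m g^h) = \det W * (1 + qform (invmx W) g).
Proof. by move=> uW; rewrite det_add_gram // det_mx11 mxE [1%:M _ _]mxE. Qed.

(** With [y = W^-1 g], [a = r^h W r] and [c = r^h g], the nonnegative form of [W] at [a y - c r]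
    equals [a (a q - |c|^2)], where [q = g^h W^-1 g]. *)
Lemma cauchy_schwarz n (W : 'M[C]_n) (g r : 'cV[C]_n) : posdef W ->
  `|(r^h *m g) 0 0| ^+ 2 <= qform W r * qform (invmx W) g.
Proof.
move=> pdW; have uW := posdef_unit pdW; have [hW pW] := pdW.
have [->|r0] := eqVneq r 0.
  by rewrite /qform adjmx0 !mul0mx !mxE normr0 expr0n mul0r.
set c := (r^h *m g) 0 0; set a := qform W r; pose y := invmx W *m g.
have a_gt0 : 0 < a := pW _ r0.
have cE : (g^h *m r) 0 0 = c^* by rewrite -adjmxE adjmxM adjmxK.
have q_ge0 : 0 <= qform W (a *: y - c *: r).
  by have [_] := posdef_psd pdW; apply.
suff : 0 <= a * (a * qform (invmx W) g - `|c| ^+ 2).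
  by rewrite pmulr_rge0 // subr_ge0.
suff <- : qform W (a *: y - c *: r) = a * (a * qform (invmx W) g - `|c| ^+ 2) by [].
have Wy : W *m y = g by rewrite /y mulKVmx.
have yW : y^h *m W = g^h by rewrite -[in LHS]hW -adjmxM Wy.
have -> : qform W (a *: y - c *: r) =
    qform W (a *: y) - a^* * c * (g^h *m r) 0 0
    - c^* * a * (r^h *m g) 0 0 + qform W (c *: r).
  rewrite /qform adjmxB !adjmxZ !mulmxBl !mulmxBr.
  rewrite -!scalemxAl -!scalemxAr yW -(mulmxA r^h) Wy !mxE.
  by rewrite !mulrA opprB addrA addrAC.
rewrite !qformZv -/a -/c cE geC0_conj ?(ltW a_gt0) //.
have -> : qform W y = qform (invmx W) g by rewrite /qform yW /y mulmxA.
rewrite ger0_norm ?(ltW a_gt0) // normCK.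
by rewrite /c; ring.
Qed.

(** * Rank reduction and unitary completion *)

(** A square root [F] of [S] is projected onto the row space of [H F]: the projection gives [B], the
    complement gives the part [K] that a receiver with channel [H] does not see. *)
Lemma psd_reduce_rank r n M (H : 'M[C]_(r, n)) (S : 'M[C]_n) :
  psd S -> (\rank H <= M)%N ->
  exists B : 'M[C]_(n, M), exists K : 'M[C]_n,
    S = B *m B^h + K *m K^h /\ H *m K = 0.
Proof.
move=> /psd_sqrt[F ->] rH; set N := H *m F.
have rN : (\rank N <= M)%N by apply: leq_trans rH; apply: mxrankM_maxl.
pose E := schmidt (row_base N).
have EE : E *m E^h = 1%:M.
  by apply/unitarymxP/schmidt_unitarymx; apply: rank_leq_col.
have NE : N *m E^h *m E = N.
  have /submxP[X NX] : (N <= E)%MS.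
    by rewrite (eqmx_schmidt_free (row_base_free N)) eq_row_base.
  transitivity (X *m E *m E^h *m E); first by congr (_ *m _ *m _).
  by rewrite -(mulmxA X) EE mulmx1.
(* The partial identity pads the [\rank N] columns with zero columns up to [M]. *)
exists (F *m E^h *m pid_mx (\rank N)), (F *m (1%:M - E^h *m E)); split; last first.
  by rewrite mulmxA -/N mulmxBr mulmx1 mulmxA NE subrr.
rewrite !adjmxM adjmxB adjmxM adjmx1 adjmxK.
have -> : (pid_mx (\rank N) : 'M[C]_(\rank N, M))^h = pid_mx (\rank N).
  by rewrite /adjmx tr_pid_mx map_pid_mx.
rewrite !mulmxA -(mulmxA _ (pid_mx _) (pid_mx _)) pid_mx_id //.
rewrite pid_mx_1 mulmx1 -(mulmxA F (1%:M - _)).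
have -> : (1%:M - E^h *m E) *m (1%:M - E^h *m E) = 1%:M - E^h *m E.
  rewrite mulmxBl mul1mx mulmxBr mulmx1 !mulmxA -(mulmxA E^h) EE mulmx1.
  by rewrite subrr subr0.
by rewrite mulmxBr mulmx1 mulmxBl !mulmxA addrC subrK.
Qed.

(** The columns of [u] and [V] form a unitary matrix. The projection [Q = 1 - u u^h] has rank at
    most [n], and [psd_reduce_rank] with [Q] as both channel and covariance yields [V]. *)
Lemma unit_norm_completion n (u : 'cV[C]_n.+1) : unit_norm u ->
  exists V : 'M[C]_(n.+1, n), 1%:M = u *m u^h + V *m V^h.
Proof.
move=> u1; have uu : u^h *m u = 1%:M by rewrite [LHS]mx11_scalar u1.
pose Q : 'M[C]_n.+1 := 1%:M - u *m u^h.
have QQ : Q *m Q^h = Q.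
  rewrite /Q adjmxB adjmxM adjmxK adjmx1 mulmxBl mul1mx mulmxBr mulmx1.
  by rewrite !mulmxA -(mulmxA u) uu mulmx1 subrr subr0.
have uQ : u^h *m Q = 0 by rewrite /Q mulmxBr mulmx1 mulmxA uu mul1mx subrr.
have u0 : u^h != 0.
  apply: contraNneq (unit_norm_neq0 u1) => u0.
  by rewrite -[u]adjmxK u0 adjmx0.
have rQ : (\rank Q <= n)%N.
  rewrite -ltnS ltn_neqAle rank_leq_row andbT.
  apply: contraNneq u0 => rQ; have fQ : row_free Q by rewrite /row_free rQ.
  by apply/eqP/(row_free_inj fQ); rewrite uQ mul0mx.
have psdQ : psd Q by rewrite -QQ; apply: psd_gram.
have [V [K [QE QK]]] := psd_reduce_rank psdQ rQ.
suff K0 : K = 0.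
  by exists V; rewrite -[LHS](subrK (u *m u^h)) -/Q QE K0 mul0mx addr0 addrC.
(* Since [Q K = 0], the two Gram terms of [K^h Q K] have traces summing to zero, so [K^h K], and
   then [K], vanishes. *)
have := congr1 (fun A => \tr (K^h *m A *m K)) QE.
rewrite -mulmxA QK mulmx0 mxtrace0 mulmxDr mulmxDl mxtraceD.
have -> : K^h *m (V *m V^h) *m K = (K^h *m V) *m (K^h *m V)^h.
  by rewrite adjmxM adjmxK !mulmxA.
have -> : K^h *m (K *m K^h) *m K = (K^h *m K) *m (K^h *m K)^h.
  by rewrite adjmxM adjmxK !mulmxA.
move=> /esym/eqP; rewrite paddr_eq0 ?trace_gram_ge0 // => /andP[_ /eqP].
move/trace_gram_eq0 => KK; apply: (can_inj (@adjmxK _ _)).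
by rewrite adjmx0; apply: trace_gram_eq0; rewrite adjmxK KK mxtrace0.
Qed.

(** * Geometric mean decomposition *)

(** The eigenvalues are positive with geometric mean [x], so one is at most [x] and one at least
    [x]; a combination of the two eigenvectors interpolates between them. *)
Lemma qform_geometric_mean n (K : 'M[C]_n) (x : C) :
  (0 < n)%N -> posdef K -> 0 < x -> \det K = x ^+ n ->
  exists2 u, unit_norm u & qform K u = x.
Proof.
case: n K => // n K _ [hK pK] x_gt0 detK.
have [P [d [PP Kd]]] := spectral_decomposition hK.
have reduce w : unit_norm w -> qform (diag_mx d) w = x ->
    exists2 u, unit_norm u & qform K u = x.
  move=> w1 wx; exists (P^h *m w).
    by rewrite /unit_norm adjmxM adjmxK mulmxA -(mulmxA _ P) PP mulmx1.
  by rewrite Kd qform_conj mulmxA PP mul1mx.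
have delta1 i : unit_norm (delta_mx i 0 : 'cV[C]_n.+1).
  by rewrite /unit_norm -qform1 -diag_const_mx qform_diag_delta mxE.
have d_gt0 i : 0 < d 0 i.
  rewrite -qform_diag_delta.
  have -> : diag_mx d = P^h^h *m K *m P^h.
    by rewrite adjmxK Kd !mulmxA PP mul1mx -mulmxA PP mulmx1.
  rewrite qform_conj; apply: pK; apply/eqP => Pd0.
  have := delta1 i; rewrite /unit_norm -[delta_mx _ _]mul1mx -PP -mulmxA Pd0 mulmx0.
  by rewrite mulmx0 mxE => /eqP; rewrite eq_sym oner_eq0.
have prodd : \prod_i d 0 i = x ^+ n.+1.
  rewrite -detK Kd !det_mulmx det_diag mulrAC -det_mulmx.
  by rewrite (unitary_adj PP) det1 mul1r.
have prodx : \prod_(i < n.+1) x = x ^+ n.+1 by rewrite prodr_const card_ord.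
(* The order on [C] is partial, so comparability has to come from reality. *)
have cmp i : d 0 i >=< x by apply: real_comparable; rewrite gtr0_real.
have [i di] : exists i, d 0 i <= x.
  apply/existsP; apply: contraT; rewrite negb_exists => /forallP lt_xd.
  suff : \prod_(i < n.+1) x < \prod_i d 0 i by rewrite prodx prodd ltxx.
  apply: ltr_prod => [|i _]; first by apply/hasP; exists ord0; rewrite ?mem_index_enum.
  by rewrite ltW //=; have := lt_xd i; rewrite -comparable_ltNge // comparable_sym.
have [j dj] : exists j, x <= d 0 j.
  apply/existsP; apply: contraT; rewrite negb_exists => /forallP lt_dx.
  suff : \prod_i d 0 i < \prod_(i < n.+1) x by rewrite prodx prodd ltxx.
  apply: ltr_prod => [|k _]; first by apply/hasP; exists ord0; rewrite ?mem_index_enum.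
  by rewrite ltW //=; have := lt_dx k; rewrite -comparable_ltNge.
have [dix|dix] := eqVneq (d 0 i) x.
  by apply: (reduce (delta_mx i 0)); rewrite ?qform_diag_delta.
have {dix}di : d 0 i < x by rewrite lt_neqAle dix.
have dij : 0 < d 0 j - d 0 i by rewrite subr_gt0 (lt_le_trans di).
have ij : i != j by apply: contraTneq di => ->; rewrite le_gtF.
(* The weight solves [a d_i + (1 - a) d_j = x]; the square roots in [w] make [a] and [1 - a] the
   squared moduli of its coordinates. *)
pose a := (d 0 j - x) / (d 0 j - d 0 i).
pose w : 'cV[C]_n.+1 := sqrtC a *: delta_mx i 0 + sqrtC (1 - a) *: delta_mx j 0.
have a_ge0 : 0 <= a by rewrite divr_ge0 ?(ltW dij) ?subr_ge0.
have a_le1 : 0 <= 1 - a.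
  by rewrite subr_ge0 ler_pdivrMr // mul1r lerD2l lerN2 ltW.
have qw (c : 'rV_n.+1) : qform (diag_mx c) w = c 0 i * a + c 0 j * (1 - a).
  rewrite qform_diag (bigD1 i) //= (bigD1 j) 1?eq_sym //= big1 => [|k /andP[ki kj]].
    rewrite !mxE !eqxx /= (negPf ij) eq_sym (negPf ij) !mulr1 !mulr0 !addr0 add0r.
    by rewrite !ger0_norm ?sqrtC_ge0 // !sqrtCK.
  by rewrite !mxE (negPf ki) (negPf kj) /= !mulr0 addr0 normr0 expr0n mulr0.
apply: (reduce w).
  by rewrite /unit_norm -qform1 -diag_const_mx qw !mxE !mul1r addrC subrK.
have aE : a * (d 0 j - d 0 i) = d 0 j - x by rewrite divfK ?gt_eqF.
rewrite qw mulrBr mulr1 addrCA -mulrBl mulrC -opprB mulrN aE.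
by rewrite opprB addrC subrK.
Qed.

(* One unit vector attaining the geometric mean of the eigenvalues of
   [1 + G^h W^-1 G] gives the stream decoded last; adding it to the noise
   leaves the same problem with one stream less. *)
Lemma equal_gain_decomposition nT nR M (H : 'M[C]_(nR, nT)) (B : 'M[C]_(nT, M))
    (W : 'M[C]_nR) (x : C) : posdef W -> 0 < x ->
  \det (W + (H *m B) *m (H *m B)^h) = x ^+ M * \det W ->
  exists b : 'I_M -> 'cV[C]_nT,
    B *m B^h = \sum_i b i *m (b i)^h /\
    forall m : 'I_M,
      qform (invmx (W + \sum_(i < M | (i < m)%N) (H *m b i) *m (H *m b i)^h))
        (H *m b m) = x - 1.
Proof.
move=> + x_gt0; elim: M B W => [|M IH] B W pdW detE.
  exists (fun=> 0); split; last by case.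
  by rewrite big_ord0 [B]thinmx0 mul0mx.
have uW := posdef_unit pdW.
set G := H *m B in detE; pose K := 1%:M + G^h *m invmx W *m G.
have pdK : posdef K.
  by apply: posdefD; [apply: posdef1|apply/psd_conj/posdef_psd/posdef_inv].
have detK : \det K = x ^+ M.+1.
  have dW : \det W != 0 by rewrite -unitfE -unitmxE.
  by apply: (mulIf dW); rewrite -detE det_add_gram // mulrC.
have [u u1 Ku] := qform_geometric_mean (ltn0Sn M) pdK x_gt0 detK.
have [V uV] := unit_norm_completion u1.
have gain : qform (invmx W) (G *m u) = x - 1.
  move: Ku; rewrite qformD qform_conj qform1 u1 => <-.
  by rewrite [1 + _]addrC addrK.
pose W' := W + (G *m u) *m (G *m u)^h.
have pdW' : posdef W' by apply: posdefD => //; apply: psd_gram.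
have split_gram p (A : 'M[C]_(p, M.+1)) :
    A *m A^h = (A *m u) *m (A *m u)^h + (A *m V) *m (A *m V)^h.
  by rewrite -{1}[A]mulmx1 uV mulmxDr mulmxDl !adjmxM !mulmxA.
have detE' : \det (W' + (H *m (B *m V)) *m (H *m (B *m V))^h) = x ^+ M * \det W'.
  rewrite {2}/W' det_add_rank1 // gain [1 + _]addrC subrK.
  rewrite mulmxA -/G -addrA -split_gram detE exprSr.
  by rewrite -mulrA [x * _]mulrC.
have [b [bB bx]] := IH _ _ pdW' detE'.
(* Index 0 is the new stream, which sees only [W]; the streams of the induction hypothesis see it as
   noise. *)
exists (fun m => if unlift ord0 m is Some m' then b m' else B *m u); split.
  rewrite split_gram big_ord_recl unlift_none bB; congr (_ + _).
  by apply: eq_bigr => i _; rewrite liftK.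
move=> m; case: (unliftP ord0 m) => [m'|] ->.
  rewrite -[RHS](bx m'); congr (qform (invmx _) _).
  rewrite big_mkcond big_ord_recl /= unlift_none [LHS]addrA mulmxA -/G.
  congr (_ + _); rewrite [RHS]big_mkcond.
  by apply: eq_bigr => i _; rewrite liftK.
by rewrite big_pred0 // addr0 mulmxA gain.
Qed.

(** * Receivers and successive decoding *)

(** The minimum mean square error receiver, [W^-1 g] normalised, is the equality case of
    [cauchy_schwarz]. *)
Lemma optimal_receiver n (W : 'M[C]_n) (g : 'cV[C]_n) : posdef W -> g != 0 ->
  exists2 r, unit_norm r &
    `|(r^h *m g) 0 0| ^+ 2 = qform (invmx W) g * qform W r.
Proof.
move=> pdW g0; have uW := posdef_unit pdW; have [hW _] := pdW.
pose y := invmx W *m g.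
have y0 : y != 0 by apply: contraNneq g0 => y0; rewrite -[g](mulKVmx uW) -/y y0 mulmx0.
have y1 : 0 < qform 1%:M y by have [_] := posdef1 n; apply.
pose c := sqrtC (qform 1%:M y).
have c_gt0 : 0 < c by rewrite sqrtC_gt0.
have yg : (y^h *m g) 0 0 = qform (invmx W) g.
  by rewrite /y adjmxM adjmx_inv hW.
have qy : qform W y = qform (invmx W) g.
  by rewrite -yg /qform -mulmxA /y mulKVmx.
have q_ge0 : 0 <= qform (invmx W) g.
  by have [_] := posdef_psd (posdef_inv pdW); apply.
exists (c^-1 *: y).
  rewrite /unit_norm -qform1 qformZv normfV ger0_norm ?(ltW c_gt0) //.
  by rewrite exprVn sqrtCK mulVf ?gt_eqF.
rewrite qformZv qy adjmxZ -scalemxAl mxE yg normrM norm_conjC.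
by rewrite (ger0_norm q_ge0); ring.
Qed.

(** Induction removes the first decoded stream: it suffers from all the others, so its factor comes
    from [det_add_rank1] over [W']. The order is opposite to that of [equal_gain_decomposition]. *)
Lemma det_successive_decoding n M (g : 'I_M -> 'cV[C]_n) (W : 'M[C]_n) (c : C) :
  posdef W -> 0 <= c ->
  (forall m : 'I_M, c <=
     1 + qform (invmx (W + \sum_(i < M | (m < i)%N) g i *m (g i)^h)) (g m)) ->
  c ^+ M * \det W <= \det (W + \sum_i g i *m (g i)^h).
Proof.
move=> pdW c_ge0; elim: M g => [|M IH] g gain.
  by rewrite big_ord0 addr0 mul1r.
set W' := W + \sum_i g (lift ord0 i) *m (g (lift ord0 i))^h.
have pdW' : posdef W' by apply: posdefD => //; apply: psd_sum => i _; apply: psd_gram.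
have IH' : c ^+ M * \det W <= \det W'.
  apply: IH => m; have := gain (lift ord0 m).
  by rewrite big_mkcond big_ord_recl /= add0r -big_mkcond.
have gain0 : c <= 1 + qform (invmx W') (g ord0).
  by have := gain ord0; rewrite big_mkcond big_ord_recl /= add0r.
rewrite big_ord_recl addrCA -/W' addrC.
rewrite det_add_rank1 ?posdef_unit // exprSr mulrAC ler_pM //.
by rewrite mulr_ge0 ?exprn_ge0 // ltW // posdef_det_gt0.
Qed.

End PositiveMatrices.

(** * Rates and SINRs of the network *)

Section Network.
Variables (C : numClosedFieldType) (L : nat) (nT nR : 'I_L -> nat).
Variable H : forall l k : 'I_L, 'M[C]_(nR l, nT k).
Variable Phi : 'I_L -> 'I_L -> bool.
Hypothesis Phi_diag : forall l, Phi l l = false.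

Lemma Omega_posdef (S : covs C L nT) l :
  (forall k, psd (S k)) -> posdef (Omega C L nT nR H Phi S l).
Proof.
move=> psdS; apply: posdefD; first exact: posdef1.
apply: psd_sum => k _; case: ifP => _; last exact: psd0.
by rewrite -{1}[H l k]adjmxK; apply: psd_conj.
Qed.

(** Clearing the inverse makes the rate a quotient of determinants of received covariances, the form
    in which the determinant lemmas apply. *)
Lemma rate_det_ratio (S : covs C L nT) l : (forall k, psd (S k)) ->
  rate_det C L nT nR H Phi S l * \det (Omega C L nT nR H Phi S l) =
  \det (Omega C L nT nR H Phi S l + H l l *m S l *m adjmx (H l l)).
Proof.
move=> psdS; have uO := posdef_unit (Omega_posdef l psdS).
by rewrite /rate_det -det_mulmx mulmxDl mul1mx mulmxKV.
Qed.

Lemma cov_of_psd (T : tvecs C L nT nR H) p l :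
  (forall l m, 0 <= p l m) -> psd (cov_of H T p l).
Proof.
move=> p_ge0; apply: psd_sum => m _.
by rewrite scale_gram //; apply: psd_gram.
Qed.

Lemma mul_cov_of l k (T : tvecs C L nT nR H) p :
  H l k *m cov_of H T p k *m (H l k)^h =
  \sum_n p k n *: ((H l k *m T k n) *m (H l k *m T k n)^h).
Proof.
rewrite mulmx_sumr mulmx_suml; apply: eq_bigr => n _.
by rewrite adjmxM -scalemxAr -scalemxAl !mulmxA.
Qed.

(** The 1 is the noise energy through a unit-norm receiver, [Omega] collects the other links, and
    the link's own streams decoded after [m] come separately; [Phi_diag] keeps the link itself out
    of [Omega]. *)
Lemma sinr_denominator (T : tvecs C L nT nR H) (R : rvecs C L nT nR H) p l m :
  unit_norm (R l m) ->
  1 + \sum_(k < L) \sum_(n < Mstreams H k) p k n * Psi C L nT nR H Phi T R l m k n =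
  qform (Omega C L nT nR H Phi (cov_of H T p) l +
         \sum_(n < Mstreams H l | (m < n)%N)
            p l n *: ((H l l *m T l n) *m (H l l *m T l n)^h)) (R l m).
Proof.
move=> r1; rewrite !qformD qform1 r1 -addrA; congr (_ + _).
rewrite [LHS](bigD1 l) //= addrC; congr (_ + _).
  rewrite qform_sum [RHS](bigD1 l) //= Phi_diag qform0 add0r.
  apply: eq_bigr => k kl; rewrite /Psi (negPf kl).
  case: (Phi l k); last first.
    by rewrite qform0 big1 // => n _; rewrite mul0r mulr0.
  rewrite mul_cov_of qform_sum; apply: eq_bigr => n _.
  by rewrite mul1r qformZ qform_rank1 mulmxA.
rewrite qform_sum [RHS]big_mkcond; apply: eq_bigr => n _; rewrite /Psi eqxx.
case: (m < n)%N; last by rewrite mul0r mulr0.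
by rewrite mul1r qformZ qform_rank1 mulmxA.
Qed.

(** Unit-norm transmit vectors give rank-one terms of trace 1, so the two objectives agree. *)
Lemma trace_cov_of (T : tvecs C L nT nR H) (R : rvecs C L nT nR H) p :
  valid_strategy C L nT nR H T R p ->
  total_power C L nT (cov_of H T p) = p_norm1 C L nT nR H p.
Proof.
move=> valid; apply: eq_bigr => l _; rewrite /cov_of linear_sum /=.
apply: eq_bigr => m _; have [t1 _] := valid l m.
by rewrite mxtraceZ mxtrace_mulC trace_mx11 t1 mulr1.
Qed.

(** * Passing between strategies and feasible covariances *)

Variable gamma0 : 'I_L -> C.
Hypothesis gamma0_gt0 : forall l, 0 < gamma0 l.

Lemma espmp_feasible_cov (T : tvecs C L nT nR H) (R : rvecs C L nT nR H) p :
  espmp_feasible H Phi gamma0 T R p -> spmp_feasible H Phi gamma0 (cov_of H T p).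
Proof.
move=> [valid feas] l.
have p_ge0 k n : 0 <= p k n by have [_ []] := valid k n.
have psdS k : psd (cov_of H T p k) by apply: cov_of_psd.
split=> //; have pdO := Omega_posdef l psdS.
rewrite -(ler_pM2r (posdef_det_gt0 pdO)) rate_det_ratio // mul_cov_of.
pose g n := sqrtC (p l n) *: (H l l *m T l n).
have gE n : p l n *: ((H l l *m T l n) *m (H l l *m T l n)^h) = g n *m (g n)^h.
  exact: scale_gram.
under eq_bigr => n _ do rewrite gE.
apply: det_successive_decoding => // [|m].
  by rewrite addr_ge0 // ltW.
rewrite lerD2l; apply: le_trans (feas l m) _.
have [_ [r1 _]] := valid l m.
rewrite /sinr sinr_denominator //.
under eq_bigr => n _ do rewrite gE.
set W := _ + _; have pdW : posdef W.
  by apply: posdefD => //; apply: psd_sum => n _; apply: psd_gram.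
have r0 : R l m != 0 by apply: unit_norm_neq0.
rewrite ler_pdivrMr; last by have [_] := pdW; apply.
(* Cauchy-Schwarz removes the receiver: any choice of it achieves at most the gain [g^h W^-1 g]. *)
rewrite [leRHS]mulrC; apply: le_trans (cauchy_schwarz _ _ pdW).
rewrite /g -scalemxAr [in leRHS]mxE normrM exprMn.
by rewrite (ger0_norm (_ : 0 <= sqrtC _)) ?sqrtC_ge0 // sqrtCK mulmxA.
Qed.

(** One link is decomposed at a time, so interference is still measured with the undecomposed
    covariances of the others. *)
Lemma spmp_feasible_streams (S : covs C L nT) l :
  (0 < Mstreams H l)%N -> spmp_feasible H Phi gamma0 S ->
  exists b : 'I_(Mstreams H l) -> 'cV[C]_(nT l),
  exists r : 'I_(Mstreams H l) -> 'cV[C]_(nR l), exists K : 'M[C]_(nT l),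
  S l = \sum_m b m *m (b m)^h + K *m K^h /\
  forall m, [/\ b m != 0, unit_norm (r m) &
    gamma0 l * qform (Omega C L nT nR H Phi S l + \sum_(n < Mstreams H l | (m < n)%N)
      (H l l *m b n) *m (H l l *m b n)^h) (r m) <=
    `|((r m)^h *m (H l l *m b m)) 0 0| ^+ 2].
Proof.
move=> M_gt0 feas; have psdS k : psd (S k) by have [] := feas k.
have [_ rate] := feas l; have pdO := Omega_posdef l psdS.
have [B [K [SE HK]]] := psd_reduce_rank (psdS l) (leqnn (Mstreams H l)).
set M := Mstreams H l in B SE M_gt0 rate *.
(* The common value of one plus the gain: [M] equal factors must multiply to the rate
   determinant. *)
pose x := M.-root (rate_det C L nT nR H Phi S l).
have g0 : 0 <= 1 + gamma0 l by rewrite addr_ge0 // ltW.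
have rate_ge0 := le_trans (exprn_ge0 M g0) rate.
have xM : x ^+ M = rate_det C L nT nR H Phi S l by rewrite rootCK.
have x_ge : 1 + gamma0 l <= x.
  by rewrite -(ler_pXn2r M_gt0) ?nnegrE ?rootC_ge0 // xM.
have x_gt0 : 0 < x by apply: lt_le_trans x_ge; rewrite addr_gt0.
have [|b [bB gain]] := equal_gain_decomposition (H := H l l) (B := B) pdO x_gt0.
  (* The part [K] is invisible through [H l l], so [B B^h] may replace [S l]. *)
  rewrite xM rate_det_ratio // SE mulmxDr mulmxDl !mulmxA HK !mul0mx addr0.
  by rewrite adjmxM !mulmxA.
(* [equal_gain_decomposition] lists the streams from the last decoded one. *)
pose W m := Omega C L nT nR H Phi S l +
  \sum_(n < M | (m < n)%N) (H l l *m b (rev_ord n)) *m (H l l *m b (rev_ord n))^h.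
have pdW m : posdef (W m).
  by apply: posdefD => //; apply: psd_sum => n _; apply: psd_gram.
have gainW (m : 'I_M) : qform (invmx (W m)) (H l l *m b (rev_ord m)) = x - 1.
  rewrite -(gain (rev_ord m)); congr (qform (invmx (_ + _)) _).
  rewrite [RHS](reindex_inj rev_ord_inj); apply: eq_bigl => n /=.
  by rewrite ltn_sub2lE ?ltnS // ltn_ord.
(* A positive gain forces each received direction to be nonzero, as [optimal_receiver] requires. *)
have x1 : 0 < x - 1.
  by rewrite subr_gt0; apply: lt_le_trans x_ge; rewrite ltrDl.
have Hb0 (m : 'I_M) : H l l *m b (rev_ord m) != 0.
  apply: contraTneq x1 => Hb; rewrite -(gainW m) Hb.
  by rewrite /qform mulmx0 mxE ltxx.
have /fin_all_exists2[r r1 rW] (m : 'I_M) := optimal_receiver (pdW m) (Hb0 m).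
exists (b \o @rev_ord M), r, K; split.
  by rewrite SE bB; congr (_ + _); rewrite [LHS](reindex_inj rev_ord_inj).
move=> m; split=> //=.
  by apply: contraNneq (Hb0 m) => ->; rewrite mulmx0.
rewrite rW gainW ler_wpM2r //; last by rewrite lerBrDl.
by have [_] := posdef_psd (pdW m); apply.
Qed.

(** Normalising the columns [b] splits them into directions and powers. Dropping every [K] only
    lowers interference, so the SINR bounds obtained against the full [S] persist. *)
Lemma spmp_feasible_strategy (S : covs C L nT) :
  (forall l, (0 < Mstreams H l)%N) -> spmp_feasible H Phi gamma0 S ->
  exists T R p, espmp_feasible H Phi gamma0 T R p /\
    forall l, exists K : 'M[C]_(nT l), S l = cov_of H T p l + K *m K^h.
Proof.
move=> M_gt0 feas.
have /fin_all_exists[b] := fun l => spmp_feasible_streams (M_gt0 l) feas.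
move=> /fin_all_exists[R] /fin_all_exists[K] streams.
pose p : pows C L nT nR H := fun l m => ((b l m)^h *m b l m) 0 0.
pose T : tvecs C L nT nR H := fun l m => (sqrtC (p l m))^-1 *: b l m.
have b0 l m : b l m != 0 by have [_ /(_ m)[]] := streams l.
have p_gt0 l m : 0 < p l m.
  by rewrite /p -qform1; have [_] := posdef1 C (nT l); apply; apply: b0.
have sp_gt0 l m : 0 < sqrtC (p l m) by rewrite sqrtC_gt0.
have bE l m : b l m = sqrtC (p l m) *: T l m.
  by rewrite /T scalerA divff ?scale1r // gt_eqF.
have gramE l q (A : 'M[C]_(q, nT l)) m :
    (A *m b l m) *m (A *m b l m)^h = p l m *: ((A *m T l m) *m (A *m T l m)^h).
  by rewrite bE -scalemxAr scale_gram ?ltW.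
have SE l : S l = cov_of H T p l + K l *m (K l)^h.
  have [-> _] := streams l; congr (_ + _); apply: eq_bigr => m _.
  by have := gramE l _ 1%:M m; rewrite !mul1mx.
have r1 l m : unit_norm (R l m) by have [_ /(_ m)[]] := streams l.
have psdcov k : psd (cov_of H T p k) by apply: cov_of_psd => *; apply: ltW.
exists T, R, p; split; last by move=> l; exists (K l).
split=> [l m|l m].
  split; last by split; rewrite ?ltW.
  rewrite /unit_norm -qform1 qformZv qform1 -/(p l m) normfV.
  by rewrite ger0_norm ?ltW // exprVn sqrtCK mulVf // gt_eqF.
have [_ /(_ m)[_ _]] := streams l.
rewrite /sinr sinr_denominator // bE -!scalemxAr [X in `|X|]mxE normrM exprMn.
rewrite (ger0_norm (ltW (sp_gt0 l m))) sqrtCK mulmxA => le_sinr.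
have pdO := Omega_posdef l psdcov.
set W := _ + _; have pdW : posdef W.
  apply: posdefD => //; apply: psd_sum => n _; rewrite -gramE; exact: psd_gram.
have r0 : R l m != 0 by apply: unit_norm_neq0.
rewrite ler_pdivlMr; last by have [_] := pdW; apply.
apply: le_trans le_sinr; rewrite ler_wpM2l ?(ltW (gamma0_gt0 l)) //.
(* Noise and the link's own later streams agree on both sides; within [Omega], each [cov_of H T p k]
   is compared with the larger [S k]. *)
rewrite /W !qformD -!addrA lerD2l lerD //; last first.
  by rewrite (eq_bigr _ (fun n _ => gramE l _ (H l l) n)).
rewrite !qform_sum; apply: ler_sum => k _; case: ifP => // _.
rewrite SE mulmxDr mulmxDl qformD lerDl.
have [_] := psd_conj (H l k)^h (psd_gram (K k)).
by rewrite adjmxK; apply.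
Qed.

(** * Comparison of total powers *)

Lemma trace_cov_le (S : covs C L nT) (T : tvecs C L nT nR H) p :
  (forall l, exists K : 'M[C]_(nT l), S l = cov_of H T p l + K *m K^h) ->
  total_power C L nT (cov_of H T p) <= total_power C L nT S.
Proof.
move=> SE; apply: ler_sum => l _; have [K ->] := SE l.
by rewrite mxtraceD lerDl trace_gram_ge0.
Qed.

(** The traces of the [K K^h] are nonnegative and sum to at most zero, so each [K] vanishes. *)
Lemma trace_cov_eq (S : covs C L nT) (T : tvecs C L nT nR H) p :
  (forall l, exists K : 'M[C]_(nT l), S l = cov_of H T p l + K *m K^h) ->
  total_power C L nT S <= total_power C L nT (cov_of H T p) ->
  forall l, S l = cov_of H T p l.
Proof.
move=> /fin_all_exists[K SE] le_tr.
have trE : \sum_l \tr (K l *m (K l)^h) = 0.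
  apply/eqP; rewrite eq_le sumr_ge0 => [|l _]; last exact: trace_gram_ge0.
  rewrite andbT -(lerD2l (total_power C L nT (cov_of H T p))) addr0.
  rewrite -big_split /=; apply: le_trans le_tr.
  by apply: ler_sum => l _; rewrite SE mxtraceD.
move=> l; rewrite SE; have -> : K l = 0.
  by apply: trace_gram_eq0; apply/(psumr_eq0P _ trE) => // k _; apply: trace_gram_ge0.
by rewrite mul0mx addr0.
Qed.

End Network.

Unset Implicit Arguments.
Set Strict Implicit.

Theorem theorem7 (C : numClosedFieldType) (L : nat) (nT nR : 'I_L -> nat)
    (H : forall l k : 'I_L, 'M[C]_(nR l, nT k)) (Phi : 'I_L -> 'I_L -> bool)
    (gamma0 : 'I_L -> C) :
  (forall l, Phi l l = false) ->
  (forall l, 0 < gamma0 l) ->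
  (forall l, (0 < Mstreams H l)%N) ->
  (exists S, spmp_feasible H Phi gamma0 S) ->
  (exists T R p, espmp_feasible H Phi gamma0 T R p) ->
  (forall T R p, espmp_optimal H Phi gamma0 T R p ->
     spmp_optimal H Phi gamma0 (cov_of H T p)) /\
  (forall S, spmp_optimal H Phi gamma0 S ->
     exists T R p, (forall l, S l = cov_of H T p l) /\ espmp_optimal H Phi gamma0 T R p).
Proof.
move=> Phi0 gamma0_gt0 M_gt0 _ _; split.
  move=> T R p [feas opt]; split; first exact: espmp_feasible_cov feas.
  (* A competitor [S] dominates the covariances of a feasible strategy, whose power is at least the
     optimal one. *)
  move=> S /(spmp_feasible_strategy Phi0 gamma0_gt0 M_gt0) [T' [R' [p' [feas' SE]]]].
  apply: le_trans (trace_cov_le SE).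
  by rewrite (trace_cov_of feas.1) (trace_cov_of feas'.1); apply: opt feas'.
move=> S [feas opt].
have [T [R [p [feasT SE]]]] := spmp_feasible_strategy Phi0 gamma0_gt0 M_gt0 feas.
have optT S' : spmp_feasible H Phi gamma0 S' ->
    total_power _ _ _ (cov_of H T p) <= total_power _ _ _ S'.
  by move=> /opt; apply: le_trans; apply: trace_cov_le.
exists T, R, p; split.
  (* The dominated covariances are feasible as well, so optimality of [S] leaves no room for a
     nonzero difference. *)
  by apply: trace_cov_eq => //; apply/opt/(espmp_feasible_cov Phi0 gamma0_gt0 feasT).
split=> // T' R' p' feas'.
rewrite -(trace_cov_of feasT.1) -(trace_cov_of feas'.1).
by apply/optT/(espmp_feasible_cov Phi0 gamma0_gt0 feas').
Qed.
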